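(* Let $r\ge 2$ be a fixed word length. The escape rate $\gamma_{w_P}$ is the same for all $w_P\in P^r$, and the escape rate $\gamma_{w_M}$ is the same for all $w_M\in M^r$. Moreover $$\gamma_{max}^r:=\max\{\gamma_w : w \text{ has length } r\}=\max\{\gamma_{w_P},\gamma_{w_M}\},$$ where $w_P$ denotes a word in $P^r$ and $w_M$ a word in $M^r$.
   Context: Let $\mathcal{A}$ be a finite alphabet with $A\ge 2$ symbols and let $(p_c)_{c\in\mathcal{A}}$ be a probability vector with $p_c>0$ for all $c\in\mathcal{A}$. Let $a$ be the most probable symbol and $b$ the second most probable one: $p:=p_a$, $q:=p_b$, $p_c\le q\le p$ for every symbol $c\ne a,b$ (ties allowed; $p+q\le 1$). Let $\mu$ be the product probability measure on $\mathcal{A}^{\mathbb{N}}$ (sequences $\omega=(\omega_0\omega_1\omega_2\dots)$) determined by this vector, and let $\sigma$ be the left shift. A word $w=(w_0w_1\dots w_{r-1})\in\mathcal{A}^r$ is identified with the hole $H=\{\omega\in\mathcal{A}^{\mathbb{N}}: \omega_i=w_i,\ 0\le i\le r-1\}$; $r$ is the length of the hole and $\mu(w)=\prod_{j=0}^{r-1}p_{w_j}$ its measure. Put $S_n=\{\omega:\sigma^i(\omega)\notin H,\ i=0,\dots,n\}$ and $p_n=\mu(S_n)$. The escape rate of $w$ is $\gamma_w:=\liminf_{n\to\infty}\frac{-\log p_n}{n}$. The hole $w\in\mathcal{A}^r$ is prime if for no $i\in\{1,\dots,r-1\}$ one has $(w_iw_{i+1}\dots w_{r-1})=(w_0w_1\dots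 w_{r-1-i})$. Define $P^r:=\{w\in\mathcal{A}^r: w \text{ is prime and } \mu(w)\ge\mu(\tilde w) \text{ for all prime } \tilde w\in\mathcal{A}^r\}$ and $M^r:=\{w\in\mathcal{A}^r:\mu(w)\ge\mu(\tilde w)\text{ for all }\tilde w\in\mathcal{A}^r\}$.
   Formalization: That the escape rate is the same for all words in M^r is proved only when p > q: if p = q it is false, since a^r and a^{r-1}b both lie in M^r with different rates (e.g. aa and ab with p = q = 1/2). The other two claims are proved with ties allowed. *)

(* Defs.v *)
From HB Require Import structures.
From mathcomp Require Import all_boot all_order all_algebra.
From mathcomp Require Import all_classical all_reals all_analysis.

Set Implicit Arguments.
Unset Strict Implicit.
Unset Printing Implicit Defensive.

Import Order.TTheory GRing.Theory Num.Theory.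

Local Open Scope classical_set_scope.
Local Open Scope ring_scope.

(* Measurable types are pointed; as an abstract [finType] has no distinguished
   element, the symbol [a] is used only to point the space at the constant
   sequence. *)
Definition full_shift (A : finType) (a : A) : Type := nat -> A.

HB.instance Definition _ (A : finType) (a : A) := Choice.on (full_shift a).
HB.instance Definition _ (A : finType) (a : A) :=
  isPointed.Build (full_shift a) (fun=> a).

Definition shift (A : finType) (omega : nat -> A) : nat -> A :=
  fun n => omega n.+1.

Definition hole (A : finType) (r : nat) (w : r.-tuple A) : set (nat -> A) :=
  [set omega | forall i : 'I_r, omega i = tnth w i].

Definition cylinders (A : finType) (a : A) : set (set (full_shift a)) :=
  [set C | exists (r : nat) (w : r.-tuple A), C = hole w].

Arguments cylinders {A} a.

Notation shift_space a := (g_sigma_algebraType (cylinders a)).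

Definition word_measure (R : realType) (A : finType) (p : A -> R) (r : nat)
    (w : r.-tuple A) : R :=
  \prod_(j < r) p (tnth w j).

(* Together with the empty set the cylinders form a pi-system generating the
   sigma-algebra, so at most one probability satisfies this condition; it
   exists as soon as [p] is a probability vector (Kolmogorov). *)
Definition is_product_measure (R : realType) (A : finType) (a : A) (p : A -> R)
    (mu : probability (shift_space a) R) : Prop :=
  forall (r : nat) (w : r.-tuple A), mu (hole w) = (word_measure p w)%:E.

Definition survivors (A : finType) (r : nat) (w : r.-tuple A) (n : nat) :
    set (nat -> A) :=
  [set omega | forall i : nat, (i <= n)%N -> ~ hole w (iter i (@shift A) omega)].

(* The value at [n = 0], where [n%:R^-1 = 0], does not affect the limit. *)
Definition escape_rate (R : realType) (A : finType) (a : A)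
    (mu : probability (shift_space a) R) (r : nat) (w : r.-tuple A) : \bar R :=
  limn_einf (fun n : nat => (- lne (mu (survivors w n)) * (n%:R^-1)%:E)%E).

Definition prime_word (A : finType) (r : nat) (w : r.-tuple A) : Prop :=
  forall i : nat, (1 <= i <= r.-1)%N -> drop i w <> take (r - i) w.

Definition max_prime_words (R : realType) (A : finType) (p : A -> R)
    (r : nat) : set (r.-tuple A) :=
  [set w | prime_word w /\
     forall w' : r.-tuple A, prime_word w' ->
       word_measure p w' <= word_measure p w].

Definition max_words (R : realType) (A : finType) (p : A -> R)
    (r : nat) : set (r.-tuple A) :=
  [set w | forall w' : r.-tuple A, word_measure p w' <= word_measure p w].

Arguments max_prime_words {R A} p r.
Arguments max_words {R A} p r.

Definition max_escape_rate (R : realType) (A : finType) (a : A)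
    (mu : probability (shift_space a) R) (r : nat) : \bar R :=
  \big[maxe/-oo%E]_(w : r.-tuple A) escape_rate mu w.

Lemma prime_word_exists (A : finType) (a b : A) (r : nat) :
  a != b -> exists w : r.-tuple A, prime_word w.
Proof.
move=> ab; case: r => [|r]; first by exists [tuple] => i /andP[]; case: i.
have sw : size (rcons (nseq r a) b) == r.+1 by rewrite size_rcons size_nseq.
exists (Tuple sw) => -[//|i] /andP[_ /= ir].
rewrite /= drop_rcons ?size_nseq// subSS -[rcons (nseq r a) b]cats1 takel_cat; last first.
  by rewrite size_nseq leq_subr.
move=> /(congr1 (fun s : seq A => b \in s)).
rewrite mem_rcons mem_head take_nseq ?leq_subr// mem_nseq eq_sym (negbTE ab).
by rewrite andbF.
Qed.

Lemma max_prime_words_nonempty (R : realType) (A : finType) (p : A -> R)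
    (a b : A) (r : nat) :
  a != b -> max_prime_words p r !=set0.
Proof.
move=> /(prime_word_exists r)[w0 w0P].
case: (@arg_maxP _ R _ w0 (fun w : r.-tuple A => `[< prime_word w >])
  (@word_measure R A p r)) => [|w /asboolP wP wmax]; first exact/asboolP.
by exists w; split => // w' w'P; exact/wmax/asboolP.
Qed.

Lemma max_words_nonempty (R : realType) (A : finType) (p : A -> R) (a : A)
    (r : nat) :
  max_words p r !=set0.
Proof.
case: (@arg_maxP _ R _ [tuple of nseq r a] xpredT (@word_measure R A p r)) => //.
by move=> w _ wmax; exists w => w'; exact: wmax.
Qed.

(* Main.v *)
(** Let [u n] be the probability that [w] does not occur among the first [n]
    letters.  If [w] occurs for the first time at position [n], then it did not
    occur among the first [n] letters, so [u (n + r - 1) - u (n + r)] is at most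
    [mu w * u n]; the two are equal when [w] is prime, since then no other
    occurrence can overlap the one at [n].  Comparing the two recurrences shows
    that the escape rate of a word is at most that of any prime word of the same
    length and at least the same measure.  The prime word [a^(r-1) b] has
    measure [p^(r-1) q], and a word of larger measure can only be [a^r], which
    is then the unique word of maximal measure. *)
Require Import Defs.
From mathcomp Require Import all_boot all_order all_algebra.
From mathcomp Require Import all_classical all_reals all_analysis.
From mathcomp Require Import zify lra.

Set Implicit Arguments.
Unset Strict Implicit.
Unset Printing Implicit Defensive.

Import Order.TTheory GRing.Theory Num.Theory.

Local Open Scope classical_set_scope.
Local Open Scope ring_scope.

(** * Shifts, limits inferior and delay recurrences *)

Lemma iter_shift (A : finType) (i j : nat) (om : nat -> A) :
  iter i (@Defs.shift A) om j = om (i + j)%N.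
Proof. by elim: i j => [//|i IH] j; rewrite iterS /Defs.shift IH addSnnS. Qed.

Lemma limn_einf_le (R : realType) (u v : nat -> \bar R) :
  (forall n, u n <= v n)%E -> (limn_einf u <= limn_einf v)%E.
Proof.
move=> uv; rewrite !limn_einf_lim; apply: lee_lim.
- exact: is_cvg_einfs.
- exact: is_cvg_einfs.
- apply: nearW => n; apply: le_ereal_inf_tmp => _ /= [k nk <-].
  by apply: le_trans (uv k); apply: ereal_inf_lbound; exists k.
Qed.

(* The ratio [v n / u n] is nondecreasing. *)
Lemma delay_recurrence_le (R : realFieldType) (r : nat) (m m' : R)
    (u v : nat -> R) :
  0 <= m' <= m ->
  (forall n, 0 < u n) -> (forall n, 0 <= v n) ->
  (forall n, (n <= r)%N -> u n = 1) -> (forall n, (n <= r)%N -> v n = 1) ->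
  (forall n, u (n + r).+1 = u (n + r)%N - m * u n) ->
  (forall n, v (n + r)%N - m' * v n <= v (n + r).+1) ->
  forall n, u n <= v n.
Proof.
move=> /andP[m'0 m'm] u0 v0 u1 v1 urec vrec.
pose rho n := v n / u n.
have rhoE n : v n = rho n * u n by rewrite /rho divfK// gt_eqF.
have rho0 n : 0 <= rho n by rewrite divr_ge0// ltW.
have rhoS n : forall k, (k <= n)%N -> rho k <= rho n.
  (* Strong induction, because the step compares the ratio at two indices that are [r] apart. *)
  elim/ltn_ind: n => -[|n] IH k; first by case: k.
  rewrite leq_eqVlt ltnS => /predU1P[->//|kn].
  apply: (le_trans (IH n (ltnSn n) k kn)).
  have [nr|rn] := ltnP n r; first by rewrite /rho !u1 ?v1// ltnW.
  rewrite /rho ler_pdivlMr// -/(rho n) -(subnK rn).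
  apply: le_trans (vrec _).
  set j := (n - r)%N; rewrite urec (rhoE (j + r)%N) (rhoE j).
  have jr : rho j <= rho (j + r)%N.
    by rewrite /j subnK//; apply: IH; rewrite // leq_subr.
  (* Since [m' <= m] and the ratio does not decrease from [j] to [j + r], [m' * v j] is at most
     [m * rho (j + r) * u j]: [v] loses at most [rho (j + r)] times what [u] loses. *)
  have := ler_pM m'0 (mulr_ge0 (rho0 j) (ltW (u0 j))) m'm
    (ler_wpM2r (ltW (u0 j)) jr).
  lra.
move=> n; have := rhoS n 0%N (leq0n n).
by rewrite /rho u1// v1// divr1 ler_pdivlMr// mul1r.
Qed.

(** * Occurrences of a word and the letters they depend on *)

Section words.
Context {A : finType}.

Definition hit {r : nat} (w : r.-tuple A) (n : nat) : set (nat -> A) :=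
  [set om | hole w (iter n (@Defs.shift A) om)].

(** Counting letters rather than shifts makes this depend on the first [n] letters alone, so that it
    is independent of [hit w n]; it is the whole space for [n < r]. *)
Definition avoid {r : nat} (w : r.-tuple A) (n : nat) : set (nat -> A) :=
  [set om | forall i, (i + r <= n)%N -> ~ hit w i om].

Definition determined (n : nat) (S : set (nat -> A)) :=
  forall om om', (forall i, (i < n)%N -> om i = om' i) -> S om -> S om'.

Lemma survivorsE (r : nat) (w : r.-tuple A) (n : nat) :
  survivors w n = avoid w (n + r).
Proof.
by apply/seteqP; split=> om S i ir; apply: S; move: ir; rewrite leq_add2r.
Qed.

Lemma determined_hit (r : nat) (w : r.-tuple A) (n : nat) :
  determined (n + r) (hit w n).
Proof.
move=> om om' eq_om H i; rewrite iter_shift -eq_om ?ltn_add2l//.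
by rewrite -iter_shift; exact: H.
Qed.

Lemma determined_avoid (r : nat) (w : r.-tuple A) (n : nat) :
  determined n (avoid w n).
Proof.
move=> om om' eq_om H i ir hi; apply: (H i ir).
by apply: (determined_hit _ hi) => j jr; rewrite eq_om// (leq_trans jr).
Qed.

Lemma hole_take (n : nat) (om : nat -> A) : hole [tuple om i | i < n] om.
Proof. by move=> i; rewrite tnth_mktuple. Qed.

(** There are finitely many words of length [n], so this reduces measurability and independence to
    cylinders. *)
Lemma determined_bigcup (n : nat) (S : set (nat -> A)) : determined n S ->
  S = \bigcup_(v in [set v : n.-tuple A | hole v `<=` S]) hole v.
Proof.
move=> dS; apply/seteqP; split=> [om Som|om [v /= vS]]; last exact: vS.
exists [tuple om i | i < n]; last exact: hole_take.
move=> om' hom'; apply: dS Som => i ni.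
by rewrite (hom' (Ordinal ni)) tnth_mktuple.
Qed.

Lemma hole_hit (n r : nat) (v : n.-tuple A) (w : r.-tuple A) :
  hole v `&` hit w n = hole [tuple of v ++ w].
Proof.
apply/seteqP; split=> om.
- move=> [hv hw] i; case: (split_ordP i) => j ->.
    by rewrite tnth_lshift; exact: hv.
  by rewrite tnth_rshift -hw iter_shift.
- move=> h; split=> i.
    by rewrite -(tnth_lshift v w) -h.
  by rewrite iter_shift -(tnth_rshift v w) -h.
Qed.

Lemma trivIset_hole (n : nat) (D : set (n.-tuple A)) :
  trivIset D (fun v => hole v).
Proof.
move=> v v' _ _ [om [hv hv']].
by apply: eq_from_tnth => i; rewrite -hv -hv'.
Qed.

Lemma avoid_le (r : nat) (w : r.-tuple A) (m n : nat) : (m <= n)%N ->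
  avoid w n `<=` avoid w m.
Proof. by move=> mn om H i ir; apply: H; exact: leq_trans mn. Qed.

(** As [w] has length [r.+1], reading one letter beyond [n + r] completes only the occurrence that
    starts at [n]. *)
Lemma avoidS (r : nat) (w : r.+1.-tuple A) (n : nat) :
  avoid w (n + r).+1 = avoid w (n + r) `\` hit w n.
Proof.
apply/seteqP; split=> om.
- by move=> H; split; [exact: avoid_le H|apply: H; rewrite addnS].
- move=> [H Hn] i; rewrite addnS ltnS leq_add2r leq_eqVlt => /predU1P[->//|ni].
  by apply: H; lia.
Qed.

(** An occurrence at [i] not excluded by [avoid w n] overlaps the one at [n]; there the suffix of
    [w] from [n - i] on agrees with a prefix, against primality. *)
Lemma avoid_hit_prime (r : nat) (w : r.+1.-tuple A) (n : nat) :
  prime_word w -> avoid w n `&` hit w n `<=` avoid w (n + r).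
Proof.
move=> wP om [H hn] i ir hi.
have [inr|ni] := leqP (i + r.+1) n; first exact: (H i).
have d0 : (1 <= n - i <= r)%N by lia.
apply: (wP _ d0).
have x0 : A by exact: (tnth w ord0).
apply: (@eq_from_nth _ x0); rewrite size_drop size_tuple ?size_takel ?size_tuple//; first by lia.
move=> j jr; rewrite nth_drop nth_take//.
have j1 : (n - i + j < r.+1)%N by lia.
have j2 : (j < r.+1)%N by lia.
have := hi (Ordinal j1); rewrite iter_shift (tnth_nth x0) /= => <-.
have := hn (Ordinal j2); rewrite iter_shift (tnth_nth x0) /= => <-.
by congr om; lia.
Qed.

Lemma avoid_small (r : nat) (w : r.-tuple A) (n : nat) : (n < r)%N ->
  avoid w n = setT.
Proof. by move=> nr; apply/seteqP; split=> // om _ i; lia. Qed.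

(** Witness for positive mass: no occurrence can start within a run of [c]. *)
Lemma avoid_constant (r : nat) (w : r.+1.-tuple A) (c : A) (n : nat) :
  c != thead w -> hole [tuple of nseq n c] `<=` avoid w n.
Proof.
move=> cw om hom i ir /(_ ord0); rewrite iter_shift addn0.
have ni : (i < n)%N by lia.
by rewrite (hom (Ordinal ni)) (tnth_nth c) nth_nseq ni => /eqP; exact/negP.
Qed.

End words.

(** * Measures of words *)

Section weight.
Context {R : realType} {A : finType}.
Variable p : A -> R.

Lemma word_measure_cat (n r : nat) (v : n.-tuple A) (w : r.-tuple A) :
  word_measure p [tuple of v ++ w] = word_measure p v * word_measure p w.
Proof.
rewrite /word_measure big_split_ord /=; congr (_ * _); apply: eq_bigr => i _.
  by rewrite tnth_lshift.
by rewrite tnth_rshift.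
Qed.

Hypothesis p_gt0 : forall c, 0 < p c.

Lemma word_measure_gt0 (n : nat) (v : n.-tuple A) : 0 < word_measure p v.
Proof. by apply: prodr_gt0. Qed.

Lemma word_measure_nseq (n : nat) (c : A) :
  word_measure p [tuple of nseq n c] = p c ^+ n.
Proof.
rewrite /word_measure (eq_bigr (fun=> p c)) ?prodr_const ?card_ord// => i _.
by rewrite (tnth_nth c) nth_nseq ltn_ord.
Qed.

Lemma word_measure_rcons_nseq (n : nat) (c d : A) :
  word_measure p [tuple of rcons (nseq n c) d] = p c ^+ n * p d.
Proof.
rewrite /word_measure big_ord_recr /= [in X in _ * X](tnth_nth d) /=.
rewrite nth_rcons size_nseq ltnn eqxx; congr (_ * _).
rewrite (eq_bigr (fun=> p c)) ?prodr_const ?card_ord// => i _.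
by rewrite (tnth_nth d) /= nth_rcons size_nseq ltn_ord nth_nseq ltn_ord.
Qed.

(** Some letter of [w] differs from [a]; its factor is at most [p b], and each of the other [n]
    factors is at most [p a]. *)
Lemma word_measure_le (n : nat) (w : n.+1.-tuple A) (a b : A) :
  (forall c, p c <= p a) -> (forall c, c != a -> p c <= p b) ->
  w <> [tuple of nseq n.+1 a] -> word_measure p w <= p a ^+ n * p b.
Proof.
move=> pa pb wa.
have [i wi] : exists i, tnth w i != a.
  apply: contra_notP wa => /forallNP wa; apply: eq_from_tnth => i.
  by rewrite [RHS](tnth_nth a) nth_nseq ltn_ord; apply/eqP/negPn/negP.
rewrite /word_measure (bigD1 i)//= mulrC.
apply: ler_pM; [by apply: prodr_ge0 => j _; exact: ltW|exact: ltW| |exact: pb].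
have -> : p a ^+ n = \prod_(j < n.+1 | j != i) p a.
  by rewrite prodr_const cardC1 card_ord.
by apply: ler_prod => j _; rewrite pa ltW.
Qed.

End weight.

(** Every nonempty suffix contains [b], while a proper prefix consists of [a] only. *)
Lemma prime_rcons_nseq (A : finType) (a b : A) (r : nat) : a != b ->
  prime_word [tuple of rcons (nseq r a) b].
Proof.
move=> ab i /andP[i0 /= ir]; rewrite drop_rcons ?size_nseq//.
rewrite -[rcons (nseq r a) b]cats1 takel_cat; last by rewrite size_nseq; lia.
move=> /(congr1 (fun s : seq A => b \in s)).
rewrite mem_rcons mem_head take_nseq; last by lia.
by rewrite mem_nseq eq_sym (negbTE ab) andbF.
Qed.

(** * Mass of the avoidance sets and comparison of escape rates *)

Section measure.
Context {R : realType} {A : finType} (p : A -> R) {a : A}.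
Variable mu : probability (shift_space a) R.
Hypothesis hmu : is_product_measure p mu.

Lemma measurable_hole (n : nat) (v : n.-tuple A) :
  measurable (hole v : set (shift_space a)).
Proof. by apply: sub_sigma_algebra; exists n, v. Qed.

Lemma determined_measurable (n : nat) (S : set (shift_space a)) :
  determined n S -> measurable S.
Proof.
move=> /determined_bigcup ->; apply: fin_bigcup_measurable => // v _.
exact: measurable_hole.
Qed.

(** Independence: on each cylinder composing [S], [hit w n] amounts to appending [w], and
    [word_measure] is multiplicative under concatenation. *)
Lemma measure_determined_hit (n r : nat) (w : r.-tuple A)
    (S : set (shift_space a)) : (forall c, 0 < p c) -> determined n S ->
  mu (S `&` hit w n) = (mu S * (word_measure p w)%:E)%E.
Proof.
move=> p_gt0 /determined_bigcup SE; rewrite SE setI_bigcupl.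
have finD : finite_set [set v : n.-tuple A | hole v `<=` S] by [].
rewrite !measure_fin_bigcup//.
- rewrite ge0_mule_fsuml//; apply: eq_fsbigr => v _.
  rewrite hole_hit; apply: (etrans (hmu _)); rewrite word_measure_cat EFinM.
  by congr (_ * _)%E; exact/esym/hmu.
- exact: trivIset_hole.
- by move=> v _; exact: measurable_hole.
- by apply: trivIset_setIr; exact: trivIset_hole.
- by move=> v _; rewrite hole_hit; exact: measurable_hole.
Qed.

Hypothesis p_gt0 : forall c, 0 < p c.

Lemma measurable_avoid (r : nat) (w : r.-tuple A) (n : nat) :
  measurable (avoid w n : set (shift_space a)).
Proof. exact: determined_measurable (@determined_avoid _ _ w n). Qed.

Lemma measurable_hit (r : nat) (w : r.-tuple A) (n : nat) :
  measurable (hit w n : set (shift_space a)).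
Proof. exact: determined_measurable (@determined_hit _ _ w n). Qed.

Definition avoid_mass (r : nat) (w : r.-tuple A) (n : nat) : R :=
  fine (mu (avoid w n)).

Lemma avoid_massE (r : nat) (w : r.-tuple A) (n : nat) :
  (avoid_mass w n)%:E = mu (avoid w n).
Proof. by rewrite fineK// fin_num_measure//; exact: measurable_avoid. Qed.

Lemma avoid_mass_ge0 (r : nat) (w : r.-tuple A) (n : nat) :
  0 <= avoid_mass w n.
Proof. exact: fine_ge0. Qed.

Lemma avoid_mass_small (r : nat) (w : r.-tuple A) (n : nat) : (n < r)%N ->
  avoid_mass w n = 1.
Proof. by move=> nr; rewrite /avoid_mass avoid_small// probability_setT. Qed.

(** Allows division by the mass in the ratio of the two recurrences. Two distinct symbols ensure a
    letter other than the first one of [w]. *)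
Lemma avoid_mass_gt0 (b : A) (r : nat) (w : r.+1.-tuple A) (n : nat) :
  a != b -> 0 < avoid_mass w n.
Proof.
move=> ab; have [c cw] : exists c, c != thead w.
  by have [aw|] := eqVneq a (thead w); [exists b; rewrite -aw eq_sym|exists a].
rewrite -lte_fin avoid_massE.
apply: (@lt_le_trans _ _ (mu (hole [tuple of nseq n c]))).
  by rewrite hmu lte_fin word_measure_gt0.
apply: le_measure; rewrite ?inE; last exact: avoid_constant.
- exact: measurable_hole.
- exact: measurable_avoid.
Qed.

Lemma avoid_massS (r : nat) (w : r.+1.-tuple A) (n : nat) :
  (avoid_mass w (n + r) - avoid_mass w (n + r).+1)%:E
    = mu (avoid w (n + r) `&` hit w n).
Proof.
have mA := measurable_avoid w (n + r); have mH := measurable_hit w n.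
have mAH := measurableI _ _ mA mH.
rewrite EFinB !avoid_massE avoidS measureD//; last by rewrite ltey_eq fin_num_measure.
by rewrite oppeB ?fin_num_adde_defl ?fin_numN ?fin_num_measure// addeA subee
  ?add0e ?fin_num_measure.
Qed.

Lemma avoid_hit_mass (r : nat) (w : r.+1.-tuple A) (n : nat) :
  mu (avoid w n `&` hit w n) = (word_measure p w * avoid_mass w n)%:E.
Proof.
rewrite (measure_determined_hit w p_gt0 (@determined_avoid _ _ w n)).
by rewrite -avoid_massE -EFinM mulrC.
Qed.

(** Enlarging [avoid w (n + r)] to [avoid w n] yields an event independent of [hit w n]. *)
Lemma avoid_massS_ge (r : nat) (w : r.+1.-tuple A) (n : nat) :
  avoid_mass w (n + r) - word_measure p w * avoid_mass w n
    <= avoid_mass w (n + r).+1.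
Proof.
rewrite lerBlDl -lerBlDr -lee_fin avoid_massS -avoid_hit_mass.
have mH := measurable_hit w n.
apply: le_measure; rewrite ?inE.
- by apply: measurableI => //; exact: measurable_avoid.
- by apply: measurableI => //; exact: measurable_avoid.
- by apply: setSI; apply: avoid_le; exact: leq_addr.
Qed.

Lemma avoid_massS_prime (r : nat) (w : r.+1.-tuple A) (n : nat) :
  prime_word w ->
  avoid_mass w (n + r).+1
    = avoid_mass w (n + r) - word_measure p w * avoid_mass w n.
Proof.
move=> wP; apply/eqP; rewrite eq_sym subr_eq addrC -subr_eq -eqe avoid_massS.
rewrite -avoid_hit_mass; apply/eqP; congr (mu _); apply/seteqP; split.
  by apply: setSI; apply: avoid_le; exact: leq_addr.
by move=> om [H h]; split=> //; exact: avoid_hit_prime (conj H h).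
Qed.

Lemma escape_rate_le_prime (b : A) (r : nat) (w w' : r.+1.-tuple A) : a != b ->
  prime_word w' -> word_measure p w <= word_measure p w' ->
  (escape_rate mu w <= escape_rate mu w')%E.
Proof.
move=> ab w'P ww'; apply: limn_einf_le => n.
rewrite !survivorsE; apply: lee_wpmul2r; first by rewrite lee_fin invr_ge0.
rewrite leeN2 lee_lne ?in_itv/= ?measure_ge0 ?leey//.
rewrite -2!avoid_massE lee_fin.
(* The prime word [w'] plays [u], whose recurrence is exact: it is avoided with the smaller
   probability, and [- lne] has reversed the order. *)
apply: (@delay_recurrence_le _ r (word_measure p w') (word_measure p w)).
- by rewrite ww' andbT ltW// word_measure_gt0.
- by move=> k; exact: (@avoid_mass_gt0 b).
- by move=> k; exact: avoid_mass_ge0.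
- by move=> k kr; rewrite avoid_mass_small.
- by move=> k kr; rewrite avoid_mass_small.
- by move=> k; exact: avoid_massS_prime.
- by move=> k; exact: avoid_massS_ge.
Qed.

End measure.

Theorem theorem3p4 (R : realType) (A : finType) (p : A -> R) (a b : A)
    (mu : probability (shift_space a) R) (r : nat)
    (hA : (2 <= #|A|)%N)
    (p_gt0 : forall c : A, 0 < p c)
    (p_sum1 : \sum_(c : A) p c = 1)
    (hab : a != b)
    (hpba : p b <= p a)
    (hpb : forall c : A, c != a -> c != b -> p c <= p b)
    (hmu : is_product_measure p mu)
    (hr : (2 <= r)%N) :
  [/\ (forall w w' : r.-tuple A,
         max_prime_words p r w -> max_prime_words p r w' ->
         escape_rate mu w = escape_rate mu w'),
      (p b < p a ->
       forall w w' : r.-tuple A,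
         max_words p r w -> max_words p r w' ->
         escape_rate mu w = escape_rate mu w') &
      (forall wP wM : r.-tuple A,
         max_prime_words p r wP -> max_words p r wM ->
         max_escape_rate mu r = maxe (escape_rate mu wP) (escape_rate mu wM))].
Proof.
case: r hr => // r _.
have pb c : c != a -> p c <= p b.
  by move=> ca; have [->//|cb] := eqVneq c b; exact: hpb.
have pa c : p c <= p a.
  by have [->//|ca] := eqVneq c a; exact: le_trans (pb c ca) hpba.
have escP (w w' : r.+1.-tuple A) := @escape_rate_le_prime _ _ p a mu hmu p_gt0 b r w w' hab.
have constE (w : r.+1.-tuple A) :
    p a ^+ r * p b < word_measure p w -> w = [tuple of nseq r.+1 a].
  by move=> lt_w; apply: contra_ltP lt_w => /(word_measure_le p_gt0 pa pb).
split=> [w w' [wP wmax] [w'P w'max]|ltpba w w' wM w'M|wP wM [wPP wPmax] wMmax].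
(* Two maximal prime words have equal measure, so the comparison applies both ways. *)
- by apply/eqP; rewrite eq_le !escP ?wmax ?w'max.
(* Strictness lifts [a^(r+1)] above the bound in [constE], which then identifies every maximal word
   with it; under a tie [a^r b] would be maximal too. *)
- have lt_max (v : r.+1.-tuple A) : max_words p r.+1 v -> v = [tuple of nseq r.+1 a].
    move=> /(_ [tuple of nseq r.+1 a]) vM; apply: constE; apply: lt_le_trans vM.
    by rewrite word_measure_nseq exprSr ltr_pM2l// exprn_gt0.
  by rewrite (lt_max w)// (lt_max w').
- apply/eqP; rewrite eq_le; apply/andP; split; last first.
    by rewrite ge_max; apply/andP; split; apply: le_bigmax.
  apply: bigmax_le => [|w _]; first exact: leNye.
  (* A word heavier than [wP] is heavier than the prime word [a^r b], hence is [a^(r+1)]; [wM] is at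
     least as heavy, so it is the same word. *)
  rewrite le_max; have [/escP->//|lt_w] := leP (word_measure p w) (word_measure p wP).
  have lt_ab : p a ^+ r * p b < word_measure p w.
    apply: le_lt_trans lt_w; rewrite -word_measure_rcons_nseq; apply: wPmax.
    exact: prime_rcons_nseq.
  by rewrite (constE wM (lt_le_trans lt_ab (wMmax w))) (constE w lt_ab) lexx orbT.
Qed.
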